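(* Let $S$ be a monoid with a zero element $0\neq 1$. Then $S$ is left $0$-steady if and only if $S$ satisfies the ascending chain condition on cyclic subacts, i.e. for every left $S$-act $A$, every ascending chain $Sa_1\subseteq Sa_2\subseteq\cdots$ of cyclic subacts of $A$ is eventually constant.
   Context: Let $S=(S,\cdot,1)$ be a monoid with a zero element $0$ (so $0\cdot s=s\cdot 0=0$ for all $s\in S$), $0\ne 1$. A left $S$-act is a nonempty set $A$ with a map $S\times A\to A$, $(s,a)\mapsto sa$, such that $1a=a$ and $(s_1s_2)a=s_1(s_2a)$. A homomorphism of $S$-acts is a map $f$ with $f(sa)=sf(a)$. For an act $A$, $0A=\{0a\mid a\in A\}$ is its set of zero elements. $S\text{-}\mathrm{Act}_0$ is the category of all left $S$-acts $A$ with a unique zero element $\theta_A$ ($0A=\{\theta_A\}$), with homomorphisms of $S$-acts (compatible with zero) as morphisms. The coproduct of a family $(A_i)_{i\in I}$ in $S\text{-}\mathrm{Act}_0$ is $\{(a_i)\in\prod_{i\in I}A_i\mid \exists j\ \forall i\neq j:\ a_i=\theta_{A_i}\}$ (the disjoint union with all zeros glued together). An act $A$ is cyclic if $A=Sa$ for some $a\in A$. An act $C\in S\text{-}\mathrm{Act}_0$ is compact if the covariant functor $\mathrm{Hom}(C,-)$ commutes with coproducts in the sense that for every nonempty family $(A_i)_{i\in I}$ of objects of $S\text{-}\mathrm{Act}_0$ the natural map $\coprod_{i\in I}\mathrm{Hom}(C,A_i)\to\mathrm{Hom}(C,\coprod_{i\in I}A_i)$ is surjective, i.e. every morphism $C\to\coprod_{i\in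 I}A_i$ factors through the canonical injection of some $A_i$. The monoid $S$ is left $0$-steady if every compact act in $S\text{-}\mathrm{Act}_0$ is cyclic. *)

(* Defs.v *)
From HB Require Import structures.
From mathcomp Require Import all_boot.
From mathcomp Require Import boolp classical_sets.

Set Implicit Arguments.
Unset Strict Implicit.
Unset Printing Implicit Defensive.

Local Open Scope group_scope.
Local Open Scope classical_set_scope.

(* [zerog != 1] is not part of the structure. *)
HB.mixin Record Monoid_hasZero S of Monoid S := {
  zerog : S;
  mul0g : left_zero zerog (@mul S);
  mulg0 : right_zero zerog (@mul S)
}.

#[short(type="monoidWithZeroType")]
HB.structure Definition MonoidWithZero := {S of Monoid_hasZero S & Monoid S}.

Reserved Notation "s |> a" (at level 45, right associativity).

Record lact (S : monoidType) := LAct {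
  lact_sort :> Type;
  lact_op : S -> lact_sort -> lact_sort;
  lact_inhabited : inhabited lact_sort;
  lact1 : forall a, lact_op 1 a = a;
  lactM : forall s t a, lact_op (s * t) a = lact_op s (lact_op t a)
}.

Notation "s |> a" := (lact_op s a) : group_scope.

Definition cyclic_subact (S : monoidType) (A : lact S) (a : A) : set A :=
  [set s |> a | s in [set: S]].

Definition cyclic_act (S : monoidType) (A : lact S) : Prop :=
  exists a : A, cyclic_subact a = [set: A].

Definition acc_cyclic_subacts (S : monoidType) : Prop :=
  forall (A : lact S) (a : nat -> A),
    (forall n, cyclic_subact (a n) `<=` cyclic_subact (a n.+1)) ->
    exists N, forall n, (N <= n)%N -> cyclic_subact (a n) = cyclic_subact (a N).

Section ActsWithZero.
Context {S : monoidWithZeroType}.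

Definition zero_elements (A : lact S) : set A :=
  [set zerog |> a | a in [set: A]].
Arguments zero_elements A : clear implicits.

Record lact0 := LAct0 {
  lact0_lact :> lact S;
  theta : lact_sort lact0_lact;
  zero_elementsE : zero_elements lact0_lact = [set theta]
}.

Lemma lact_zerog (A : lact0) (a : A) : zerog |> a = theta A.
Proof.
have : zero_elements A (zerog |> a) by exists a.
by rewrite zero_elementsE.
Qed.

Lemma lact_theta (A : lact0) (s : S) : s |> theta A = theta A.
Proof. by rewrite -{1}(lact_zerog (theta A)) -lactM mulg0 lact_zerog. Qed.

Record hom (A B : lact0) := Hom {
  hom_fun :> A -> B;
  homM : forall s a, hom_fun (s |> a) = s |> hom_fun a
}.

(* Compatibility with the zeros is automatic. *)
Lemma hom_theta (A B : lact0) (f : hom A B) : f (theta A) = theta B.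
Proof. by rewrite -(lact_zerog (theta A)) homM lact_zerog. Qed.

Section Coproduct.
Variables (I : Type) (I_inh : inhabited I) (A : I -> lact0).

Definition coprod_sort : Type :=
  {x : forall i, A i | exists j, forall i, i <> j -> x i = theta (A i)}.

Definition coprod_op (s : S) (x : coprod_sort) : coprod_sort.
Proof.
exists (fun i => s |> sval x i).
by case: (svalP x) => j xj; exists j => i /xj ->; rewrite lact_theta.
Defined.

Definition coprod_theta : coprod_sort.
Proof.
exists (fun i => theta (A i)).
by case: I_inh => j; exists j.
Defined.

Lemma coprod_eq (x y : coprod_sort) :
  (forall i, sval x i = sval y i) -> x = y.
Proof.
case: x y => [x xP] [y yP] /= xy; apply: eq_exist.
exact: functional_extensionality_dep.
Qed.

Lemma coprod_op1 x : coprod_op 1 x = x.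
Proof. by apply: coprod_eq => i; rewrite /= lact1. Qed.

Lemma coprod_opM s t x : coprod_op (s * t) x = coprod_op s (coprod_op t x).
Proof. by apply: coprod_eq => i; rewrite /= lactM. Qed.

Definition coprod_lact : lact S :=
  LAct (inhabits coprod_theta) coprod_op1 coprod_opM.

Lemma coprod_zero_elements :
  zero_elements coprod_lact = [set (coprod_theta : coprod_lact)].
Proof.
have E (x : coprod_lact) : zerog |> x = coprod_theta :> coprod_lact.
  by apply: coprod_eq => i; rewrite /= lact_zerog.
apply/seteqP; split=> [_ [x _ <-]|_ ->]; first exact: E.
by exists (coprod_theta : coprod_lact) => //; exact: E.
Qed.

Definition coprod : lact0 := LAct0 coprod_zero_elements.

(* The family equal to [a] at [i] and to [theta] elsewhere; [{classic I}]
   gives [I] the decidable equality required by [dfwith]. *)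
Definition coprod_inj_fun (i : I) (a : A i) : coprod.
Proof.
exists (@dfwith {classic I} A (fun j => theta (A j)) i a).
by exists i => j ji; rewrite dfwith_out//; apply/eqP => /esym.
Defined.

Lemma coprod_inj_funM i s (a : A i) :
  coprod_inj_fun (s |> a) = s |> coprod_inj_fun a.
Proof.
apply: coprod_eq => j /=.
case: (@dfwithP {classic I} A _ i a j) => [|k ik]; first by rewrite dfwith_in.
by rewrite dfwith_out// lact_theta.
Qed.

Definition coprod_inj (i : I) : hom (A i) coprod := Hom (@coprod_inj_funM i).

End Coproduct.

Definition compact_act (C : lact0) : Prop :=
  forall (I : Type) (I_inh : inhabited I) (A : I -> lact0)
         (f : hom C (coprod I_inh A)),
    exists (i : I) (g : hom C (A i)), f =1 coprod_inj I_inh A i \o g.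

End ActsWithZero.

Arguments lact0 S : clear implicits.

Definition left_zero_steady (S : monoidWithZeroType) : Prop :=
  forall C : lact0 S, compact_act C -> cyclic_act C.

(* Main.v *)
(** An act with unique zero is compact if and only if it is locally cyclic, i.e.
    any two of its elements lie in a common cyclic subact.  If [C] is locally
    cyclic, a morphism to a coproduct cannot hit two components, since both
    values would be multiples of a single one.  Conversely, if no [Sx] contains
    both [a] and [b], then [C] is the union of the subacts
    [{x | a \notin Sx}] and [{x | b \notin Sx}], both proper, and it maps to the
    coproduct of the two quotients without factoring through either.
    A locally cyclic act that is not cyclic contains a strictly ascending
    sequence of cyclic subacts; conversely the union of an ascending sequence of
    cyclic subacts is locally cyclic, and if it is cyclic the sequence stops. *)
Require Import Defs.
From mathcomp Require Import all_boot.
From mathcomp Require Import boolp classical_sets.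

Set Implicit Arguments.
Unset Strict Implicit.
Unset Printing Implicit Defensive.

Local Open Scope group_scope.
Local Open Scope classical_set_scope.

(** * Cyclic subacts and local cyclicity *)

Section CyclicSubact.
Context {S : monoidType} {A : lact S}.
Implicit Types (a b : A) (s : S).

Lemma cyclic_subact_refl a : cyclic_subact a a.
Proof. by exists 1 => //; rewrite lact1. Qed.

Lemma cyclic_subact_act s a : cyclic_subact a (s |> a).
Proof. by exists s. Qed.

Lemma sub_cyclic_subact a b :
  cyclic_subact b a -> cyclic_subact a `<=` cyclic_subact b.
Proof. by move=> [s _ <-] _ [t _ <-]; exists (t * s) => //; rewrite lactM. Qed.

Lemma cyclic_subact_chain (a : nat -> A) :
    (forall n, cyclic_subact (a n) `<=` cyclic_subact (a n.+1)) ->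
  forall m n, (m <= n)%N -> cyclic_subact (a m) `<=` cyclic_subact (a n).
Proof.
move=> a_asc m n /subnK <-; elim: (n - m)%N => [|k IHk] //.
exact: subset_trans IHk (a_asc _).
Qed.

End CyclicSubact.

Definition locally_cyclic (S : monoidType) (A : lact S) : Prop :=
  forall a b : A, exists c, cyclic_subact c a /\ cyclic_subact c b.

(** If no element generates [A], each [a] misses some [b], and a common generator of [a] and [b]
    generates strictly more than [a]; iterating a choice of it breaks the chain condition. *)
Lemma acc_locally_cyclic (S : monoidType) (A : lact S) :
  acc_cyclic_subacts S -> locally_cyclic A -> cyclic_act A.
Proof.
move=> acc lcA; apply: contrapT => ncA.
have step (a : A) : exists c : A,
    cyclic_subact c a /\ ~ cyclic_subact c `<=` cyclic_subact a.
  have [b Nab] : exists b, ~ cyclic_subact a b.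
    apply: contrapT => aP; apply: ncA; exists a; apply/seteqP; split=> // b _.
    by apply: contrapT => Nab; apply: aP; exists b.
  have [c [ca cb]] := lcA a b.
  by exists c; split=> // sub_ca; apply/Nab/sub_ca.
have [f fP] := choice step.
have [a0] := lact_inhabited A.
pose a n := iter n f a0.
have [n|N /(_ N.+1 (leqnSn N)) aN] := acc A a.
  by have [+ _] := fP (a n); apply: sub_cyclic_subact.
by have [_] := fP (a N); apply; rewrite -aN.
Qed.

(** * Compact acts are the locally cyclic ones *)

Section Compactness.
Context {S : monoidWithZeroType}.

(* The cofree act on [Prop], restricted to the [X] with [~ X 0] so as to have a
   unique zero.  It replaces all the Rees quotients: the subact
   [{x | a \notin Sx}] is the kernel of [x |-> {s | a \in S(sx)}]. *)
Definition cofree_sort : Type := {X : set S | ~ X zerog}.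

Lemma cofree_op_subproof (t : S) (X : cofree_sort) : ~ sval X (zerog * t).
Proof. by rewrite mul0g; exact: (svalP X). Qed.

Definition cofree_op (t : S) (X : cofree_sort) : cofree_sort :=
  exist (fun Y : set S => ~ Y zerog) [set s | sval X (s * t)]
    (@cofree_op_subproof t X).

Lemma cofree_eq (X Y : cofree_sort) : sval X = sval Y -> X = Y.
Proof. by case: X Y => [X ?] [Y ?] /=; exact: eq_exist. Qed.

Lemma cofree_op1 X : cofree_op 1 X = X.
Proof. by apply/cofree_eq/funext => s; rewrite /= mulg1. Qed.

Lemma cofree_opM s t X : cofree_op (s * t) X = cofree_op s (cofree_op t X).
Proof. by apply/cofree_eq/funext => u; rewrite /= mulgA. Qed.

Definition cofree_theta : cofree_sort := exist _ set0 id.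

Definition cofree_lact : lact S :=
  LAct (inhabits cofree_theta) cofree_op1 cofree_opM.

Lemma cofree_zero_elements :
  @zero_elements S cofree_lact = [set (cofree_theta : cofree_lact)].
Proof.
have E (X : cofree_lact) : zerog |> X = cofree_theta :> cofree_lact.
  apply/cofree_eq/seteqP; split=> s //=.
  by rewrite mulg0; exact: (svalP X).
apply/seteqP; split=> [_ [X _ <-]|_ ->]; first exact: E.
by exists (cofree_theta : cofree_lact) => //; exact: E.
Qed.

Definition cofree : lact0 S := LAct0 cofree_zero_elements.

Section Characteristic.
Variables (C : lact0 S) (a : C).
Hypothesis a_neq0 : a <> theta C.

(** Only [theta C] lies below [zerog |> x], and [a_neq0] sets [a] apart from it. *)
Lemma char_subproof (x : C) : ~ cyclic_subact (zerog |> x) a.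
Proof. by move=> [s _]; rewrite lact_zerog lact_theta => /esym. Qed.

Definition char_fun (x : C) : cofree :=
  exist (fun X : set S => ~ X zerog) [set s | cyclic_subact (s |> x) a]
    (@char_subproof x).

Lemma char_funM t x : char_fun (t |> x) = t |> char_fun x.
Proof. by apply/cofree_eq/funext => s; rewrite /= lactM. Qed.

Lemma char_fun_eq0 x : char_fun x = theta cofree <-> ~ cyclic_subact x a.
Proof.
split=> [/(congr1 sval)/= x0 xa|Nxa].
  by have : @set0 S 1 by rewrite -x0 /= lact1.
apply/cofree_eq/seteqP; split=> s //= sxa; apply: Nxa.
exact: sub_cyclic_subact (cyclic_subact_act s x) _ sxa.
Qed.

End Characteristic.

(** The exceptional index of [x] can only be [i]. *)
Lemma coprod_comp_eq0 (I : Type) (I_inh : inhabited I) (A : I -> lact0 S)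
    (x : coprod I_inh A) (i j : I) :
  sval x i <> theta (A i) -> i <> j -> sval x j = theta (A j).
Proof.
case: x => x [k xk] /= xi ij; apply: (xk) => kj; subst k.
by apply: xi; exact: xk ij.
Qed.

Lemma coprod_injP (I : Type) (I_inh : inhabited I) (A : I -> lact0 S)
    (x : coprod I_inh A) (i : I) :
  (forall j, i <> j -> sval x j = theta (A j)) ->
  x = coprod_inj I_inh A i (sval x i).
Proof.
move=> xi; apply: coprod_eq => j /=.
case: (@dfwithP {classic I} A _ i (sval x i) j) => [//|k /eqP ik].
exact: xi.
Qed.

Lemma coprod_inj_out (I : Type) (I_inh : inhabited I) (A : I -> lact0 S)
    (i j : I) (a : A i) :
  i <> j -> sval (coprod_inj I_inh A i a) j = theta (A j).
Proof. by move=> ij /=; rewrite dfwith_out//; apply/eqP. Qed.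

Lemma locally_cyclic_compact (C : lact0 S) : locally_cyclic C -> compact_act C.
Proof.
move=> lcC I I_inh A f.
(* Once a single index carries all values of [f], the factor [g] is the component of [f] there. *)
suff [i fi] : exists i, forall x j, i <> j -> sval (f x) j = theta (A j).
  have gM s x : sval (f (s |> x)) i = s |> sval (f x) i by rewrite homM.
  by exists i, (Hom gM) => x; apply: coprod_injP; exact: fi.
have [[x [i fxi]]|f0] := pselect (exists x i, sval (f x) i <> theta (A i)).
  (* The common generator [z] is nonzero at [i] because its multiple [x] is; so [z], and with it
     [y], vanishes at every other index. *)
  exists i => y j ij; have [z [[s _ sz] [t _ tz]]] := lcC x y.
  have fzi : sval (f z) i <> theta (A i).
    by move=> fzi; apply: fxi; rewrite -sz homM /= fzi lact_theta.
  by rewrite -tz homM /= (coprod_comp_eq0 fzi ij) lact_theta.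
(* Here [f] is zero, and any index serves. *)
have [i] := I_inh; exists i => x j _.
by apply: contrapT => fxj; apply: f0; exists x, j.
Qed.

Lemma compact_locally_cyclic (C : lact0 S) : compact_act C -> locally_cyclic C.
Proof.
move=> cC a b.
have theta_in (x : C) : cyclic_subact x (theta C).
  by rewrite -(lact_zerog x); exact: cyclic_subact_act.
have [->|a0] := pselect (a = theta C).
  by exists b; split; [exact: theta_in|exact: cyclic_subact_refl].
have [->|b0] := pselect (b = theta C).
  by exists a; split; [exact: cyclic_subact_refl|exact: theta_in].
apply: contrapT => Nab.
pose F x (i : bool) : cofree := if i then char_fun a0 x else char_fun b0 x.
(* Both components are nonzero only if [x] generates both [a] and [b], which [Nab] forbids. *)
have FP x : exists j, forall i, i <> j -> F x i = theta cofree.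
  have [xa|Nxa] := pselect (cyclic_subact x a).
    exists true => -[] // _; apply/char_fun_eq0 => xb.
    by apply: Nab; exists x.
  by exists false => -[] // _; apply/char_fun_eq0.
pose f x : coprod (inhabits true) (fun=> cofree) := exist _ (F x) (FP x).
have fM s x : f (s |> x) = s |> f x.
  by apply: coprod_eq => -[]; exact: char_funM.
have [i [g fg]] := cC _ _ _ (Hom fM).
have {g fg}F0 x j : i <> j -> F x j = theta cofree.
  move=> ij.
  rewrite -(coprod_inj_out (inhabits true) (A := fun=> cofree) (g x) ij).
  by have /(congr1 (fun y => sval y j)) := fg x.
(* The component away from [i] vanishes on all of [C], yet it tests for [b] (or [a]), which lies in
   its own cyclic subact. *)
case: i F0 => F0.
  have /char_fun_eq0 := F0 b false (fun e => notF (esym e)).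
  by apply; exact: cyclic_subact_refl.
have /char_fun_eq0 := F0 a true (@notF).
by apply; exact: cyclic_subact_refl.
Qed.

End Compactness.

(** * The union of an ascending chain of cyclic subacts *)

Section ChainUnion.
Context {S : monoidWithZeroType} {A : lact S} (a : nat -> A).
Hypothesis a_asc : forall n, cyclic_subact (a n) `<=` cyclic_subact (a n.+1).

Definition chain_sort : Type := {x : A | exists n, cyclic_subact (a n) x}.

Lemma chain_op_subproof (s : S) (x : chain_sort) :
  exists n, cyclic_subact (a n) (s |> sval x).
Proof.
case: x => x [n xn] /=; exists n.
exact: sub_cyclic_subact xn _ (cyclic_subact_act s x).
Qed.

Definition chain_op (s : S) (x : chain_sort) : chain_sort :=
  exist _ (s |> sval x) (chain_op_subproof s x).

Lemma chain_eq (x y : chain_sort) : sval x = sval y -> x = y.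
Proof. by case: x y => [x ?] [y ?] /=; exact: eq_exist. Qed.

Lemma chain_op1 x : chain_op 1 x = x.
Proof. by apply: chain_eq; rewrite /= lact1. Qed.

Lemma chain_opM s t x : chain_op (s * t) x = chain_op s (chain_op t x).
Proof. by apply: chain_eq; rewrite /= lactM. Qed.

Definition chain_elt n : chain_sort :=
  exist _ (a n) (ex_intro _ n (cyclic_subact_refl (a n))).

Definition chain_lact : lact S :=
  LAct (inhabits (chain_elt 0)) chain_op1 chain_opM.

Lemma chain_cyclic_subact (x y : chain_lact) :
  cyclic_subact x y <-> cyclic_subact (sval x) (sval y).
Proof.
split=> [[s _ <-]|[s _ sxy]]; first exact: cyclic_subact_act.
by exists s => //; exact: chain_eq.
Qed.

Lemma chain_locally_cyclic : locally_cyclic chain_lact.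
Proof.
move=> x y; case: (svalP x) (svalP y) => [m xm] [n yn].
exists (chain_elt (maxn m n)); split; apply/chain_cyclic_subact.
  exact: cyclic_subact_chain (leq_maxl _ _) _ xm.
exact: cyclic_subact_chain (leq_maxr _ _) _ yn.
Qed.

(** Both sides equal [zerog |> z] for a common generator [z]. Hence the union of a chain has a
    unique zero even when [A] has several. *)
Lemma locally_cyclic_zero (B : lact S) (x y : B) :
  locally_cyclic B -> zerog |> x = zerog |> y.
Proof.
move=> lcB; have [z [[s _ <-] [t _ <-]]] := lcB x y.
by rewrite -!lactM !mul0g.
Qed.

Lemma chain_zero_elements :
  @zero_elements S chain_lact = [set zerog |> (chain_elt 0 : chain_lact)].
Proof.
apply/seteqP; split=> [_ [x _ <-]|_ ->]; last by exists (chain_elt 0).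
exact: locally_cyclic_zero chain_locally_cyclic.
Qed.

Definition chain_lact0 : lact0 S := LAct0 chain_zero_elements.

(** A generator [u] of the union already lies in the subact of some [a N], which therefore contains
    every [a n]. *)
Lemma cyclic_chain_stops : cyclic_act chain_lact ->
  exists N, forall n, (N <= n)%N -> cyclic_subact (a n) = cyclic_subact (a N).
Proof.
move=> [u uT]; have [N uN] := svalP u; exists N => n Nn.
apply/seteqP; split; last exact: cyclic_subact_chain.
apply: sub_cyclic_subact; apply: (sub_cyclic_subact uN).
by apply/(chain_cyclic_subact u (chain_elt n)); rewrite uT.
Qed.

End ChainUnion.

Theorem theorem22 (S : monoidWithZeroType) (zerog_neq1 : (zerog : S) <> 1%g) :
  left_zero_steady S <-> acc_cyclic_subacts S.
Proof.
split=> [steady A a a_asc|acc C cC].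
  apply: (cyclic_chain_stops a_asc); apply: (steady (chain_lact0 a_asc)).
  apply: (@locally_cyclic_compact S (chain_lact0 a_asc)).
  exact: (chain_locally_cyclic a_asc).
exact: acc_locally_cyclic acc (compact_locally_cyclic cC).
Qed.
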